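(* Let $b$ be a barrier function satisfying the assumptions listed in the context. For $\rho^*>0$ define $\psi_{\rho^*}$ by $$\psi_{\rho^*}(t)=\min_{z\ge 0}\{\rho^* z+b(t-z)\},\qquad t\in\mathbb{R}.$$ Then for every $\rho^*>0$ one has that $$\psi_{\rho^*}(t)=\begin{cases} b(t) & \text{if } b'(t)\le\rho^*,\\ \rho^* t-b^*(\rho^* ) & \text{otherwise,}\end{cases}$$ is convex, Lipschitz differentiable (that is, differentiable with globally Lipschitz continuous derivative), and $\rho^*$-Lipschitz continuous, with derivative $\psi_{\rho^*}'(t)=\min\{b'(t),\rho^*\}$. Moreover, for any convex function $c:\mathbb{R}^n\to\mathbb{R}$, the composition $\psi_{\rho^*}\circ c$ is also convex.
   Context: Barrier assumptions: $b:\mathbb{R}\to\mathbb{R}\cup\{\pm\infty\}$ is proper, lower semicontinuous, and twice continuously differentiable on its domain $\operatorname{dom} b=(-\infty,0)$ (so $b=\infty$ on $[0,\infty)$), with $b'>0$ and $b''>0$ there. In the formulas, $b'(t)$ is read as $\infty$ for $t\ge 0$. The convex conjugate is $b^*(\tau)=\sup_{t\in\mathbb{R}}\{\tau t-b(t)\}$.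
   Formalization: The minimum defining ψ is assumed to be attained (it fails for b(t) = t − 1/t, ρ* ≤ 1), and global Lipschitz continuity of ψ' is claimed only when b'' is bounded above near −∞, since otherwise spikes of b'' make it false. *)

(* Defs.v *)
From mathcomp Require Import all_boot all_order all_algebra.
From mathcomp Require Import all_classical all_reals all_analysis.

Set Implicit Arguments.
Unset Strict Implicit.
Unset Printing Implicit Defensive.

Import Order.TTheory GRing.Theory Num.Theory.
Import numFieldNormedType.Exports.

Local Open Scope classical_set_scope.
Local Open Scope ring_scope.
Local Open Scope ereal_scope.

Definition dom (R : realType) (f : R -> \bar R) : set R :=
  [set t | f t < +oo].

Definition proper_function (R : realType) (f : R -> \bar R) : Prop :=
  (forall t, f t != -oo) /\ dom f !=set0.

Definition C2_at (R : realType) (g : R -> R) (t : R) : Prop :=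
  [/\ derivable g t 1%R, derivable (derive1 g) t 1%R
    & {for t, continuous (derive1n 2 g)}].

(* [fine \o b] agrees with [b] on the open set [dom b], so its derivatives at
   points of [dom b] are those of [b]. *)
Record barrier (R : realType) (b : R -> \bar R) : Prop := Barrier {
  barrier_proper : proper_function b;
  barrier_lsc : lower_semicontinuous b;
  barrier_dom : dom b = [set t | (t < 0)%R];
  barrier_C2 : forall t : R, (t < 0)%R -> C2_at (fine \o b) t;
  barrier_d1_gt0 : forall t : R, (t < 0)%R -> (0 < derive1 (fine \o b) t)%R;
  barrier_d2_gt0 : forall t : R, (t < 0)%R -> (0 < derive1n 2 (fine \o b) t)%R }.

Definition barrier_deriv (R : realType) (b : R -> \bar R) (t : R) : \bar R :=
  if (t < 0)%R then (derive1 (fine \o b) t)%:E else +oo.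

Definition conjugate (R : realType) (f : R -> \bar R) (tau : R) : \bar R :=
  ereal_sup [set (tau * t)%:E - f t | t in [set: R]].

Definition psi_objective (R : realType) (b : R -> \bar R) (rho t z : R) :
  \bar R := (rho * z)%:E + b (t - z)%R.

(* An infimum; it is the minimum exactly when [psi_attained] holds. *)
Definition psi (R : realType) (b : R -> \bar R) (rho t : R) : \bar R :=
  ereal_inf [set psi_objective b rho t z | z in [set z : R | (0 <= z)%R]].

(* The minimum over [z >= 0] defining [psi b rho] exists at every point.  For a
   barrier this can only fail when [rho] does not exceed the infimum of [b'],
   as for [b t = t - 1 / t] and [rho <= 1]. *)
Definition psi_attained (R : realType) (b : R -> \bar R) (rho : R) : Prop :=
  forall t : R, exists2 z : R,
    (0 <= z)%R & psi b rho t = psi_objective b rho t z.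

(* [b''] may have unbounded narrow spikes as [t] tends to [-oo] while [b']
   stays bounded there; [b'], hence [min {b', rho}], is then not globally
   Lipschitz. *)
Definition d2_bounded_at_ninfty (R : realType) (b : R -> \bar R) : Prop :=
  exists M : R, \forall t \near -oo%R, (derive1n 2 (fine \o b) t <= M)%R.

(* Main.v *)
(* Attainment of the minimum at t = 0 yields s < 0 with b'(s) = rho, and the
   minimum at t is then reached where t - z = min t s, so that
   psi t = b (min t s) + rho (t - min t s).  Convexity of b shows that
   p t = b'(min t s) is a subgradient of psi at t.  As p is continuous with
   values in ]0, rho], psi is convex, nondecreasing, rho-Lipschitz, and
   differentiable with derivative p. *)
Require Import Defs.
From mathcomp Require Import all_boot all_order all_algebra.
From mathcomp Require Import all_classical all_reals all_analysis.
From mathcomp Require Import ring lra.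

Set Implicit Arguments.
Unset Strict Implicit.
Unset Printing Implicit Defensive.

Import Order.TTheory GRing.Theory Num.Theory.
Import numFieldNormedType.Exports.

Local Open Scope classical_set_scope.
Local Open Scope ring_scope.

(** Dividing by [e], of either sign, places the quotient between [u] and [v]. *)
Lemma difference_quotient_dist (R : realFieldType) (u v d e : R) :
  e != 0 -> u * e <= d -> d <= v * e -> `|u - e^-1 * d| <= `|u - v|.
Proof.
move=> e0 ud dv; rewrite mulrC distrC [leRHS]distrC.
have [e1|e1|e1] := ltgtP e 0; last by rewrite e1 eqxx in e0.
- have L : v <= d / e by rewrite ler_ndivlMr.
  have U : d / e <= u by rewrite ler_ndivrMr.
  by rewrite !ler0_norm ?subr_le0 ?(le_trans L)//; lra.
- have L : d / e <= v by rewrite ler_pdivrMr.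
  have U : u <= d / e by rewrite ler_pdivlMr.
  by rewrite !ger0_norm ?subr_ge0 ?(le_trans U)// lerB.
Qed.

(** * Functions on the line with a subgradient at every point *)

Section subgradient.
Context {R : realType} (h p : R -> R).
Hypothesis hp : forall x y, p x * (y - x) <= h y - h x.

Lemma subgradient_conv (t : {i01 R}) (x y : R^o) :
  h (conv t x y) <= conv t (h x : R^o) (h y : R^o).
Proof.
rewrite [leRHS]convRE; set m := conv t x y.
have mE : m = t%:num * x + unstable.onem t%:num * y by rewrite /m convRE.
have t0 : 0 <= t%:num :> R by [].
have t1 : t%:num <= 1 :> R by [].
move: (hp m x) (hp m y); rewrite /unstable.onem in mE *.
move: (t%:num) t0 t1 mE => s s0 s1 mE hx hy.
have H1 : s * (p m * (x - m)) <= s * (h x - h m) by rewrite ler_wpM2l.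
have H2 : (1 - s) * (p m * (y - m)) <= (1 - s) * (h y - h m).
  by rewrite ler_wpM2l// subr_ge0.
(* The linear terms cancel because [m] is the weighted mean of [x] and [y]. *)
have E0 : s * (p m * (x - m)) + (1 - s) * (p m * (y - m)) = 0.
  by rewrite mE; ring.
have : 0 <= s * (h x - h m) + (1 - s) * (h y - h m) by rewrite -E0 lerD.
lra.
Qed.

(** The subgradient inequalities at [x] and at [e + x] trap the difference quotient between [p x]
    and [p (e + x)]. *)
Lemma subgradient_derivable (x : R) : {for x, continuous p} ->
  is_derive x 1 h (p x).
Proof.
move=> px.
have hlim : e^-1 *: ((h \o shift x) (e *: 1) - h x) @[e --> 0^'] --> p x.
  apply/cvgrPdist_lt => eps eps0.
  have : \forall e \near 0^', `|p x - p (e + x)| < eps.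
    apply: cvg_within.
    have : p (e + x) @[e --> 0] --> p x.
      rewrite -{2}(add0r x).
      apply: continuous_comp; last by rewrite add0r.
      by apply: cvgD; [exact: cvg_id|exact: cvg_cst].
    by move/cvgrPdist_lt/(_ _ eps0).
  apply: filterS2 (nbhs_dnbhs_neq 0) => e e0; apply: le_lt_trans.
  rewrite /= /GRing.scale/= mulr1.
  have L := hp x (e + x); have U := hp (e + x) x.
  apply: difference_quotient_dist => //.
    by move: L; rewrite addrK.
  move: U; rewrite opprD addrCA subrr addr0 mulrN -opprB lerN2.
  exact.
apply: DeriveDef; first by apply/cvg_ex; exists (p x).
exact: cvg_lim hlim.
Qed.

Lemma subgradient_dist (L x y : R) : (forall z, `|p z| <= L) ->
  `|h x - h y| <= L * `|x - y|.
Proof.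
move=> pL.
have up a b : h a - h b <= L * `|a - b|.
  have H : h a - h b <= p a * (a - b) by have := hp a b; lra.
  apply: (le_trans H); apply: (le_trans (ler_norm _)).
  by rewrite normrM ler_wpM2r.
by rewrite ler_norml up andbT lerNl opprB distrC up.
Qed.

End subgradient.

(** * Mean value theorem on an open half-line, and its consequences *)

Section half_line.
Context {R : realType} (a : R).

Lemma MVT_half_line (f : R -> R) (x y : R) :
  (forall z, z < a -> derivable f z 1) -> x < a -> y < a ->
  exists2 c, Order.min x y <= c <= Order.max x y
    & f y - f x = derive1 f c * (y - x).
Proof.
move=> df; wlog xy : x y / x <= y => [H xa ya|xa ya].
  have [xy|/ltW yx] := leP x y.
    by have := H x y xy xa ya; rewrite min_l ?max_r.
  have [c] := H y x yx ya xa; rewrite min_l// max_r// => cyx E.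
  by exists c => //; rewrite -opprB E -mulrN opprB.
rewrite min_l// max_r//.
have dfa z : z <= y -> derivable f z 1.
  by move=> zy; apply: df; exact: le_lt_trans ya.
have [||c cxy ->] := @MVT_segment R f (derive1 f) x y xy; last by exists c.
- move=> z; rewrite in_itv/= => /andP[_ zy].
  by rewrite derive1E; apply: DeriveDef => //; apply/dfa/ltW.
- apply: derivable_within_continuous => z; rewrite in_itv/= => /andP[_ zy].
  exact: dfa.
Qed.

Lemma ge0_derive1_half_line (f : R -> R) (x y : R) :
  (forall z, z < a -> derivable f z 1) ->
  (forall z, z < a -> 0 <= derive1 f z) ->
  y < a -> x <= y -> f x <= f y.
Proof.
move=> df f0 ya xy; have xa := le_lt_trans xy ya.
have [c /andP[_ cM] E] := MVT_half_line df xa ya.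
rewrite -subr_ge0 E mulr_ge0 ?subr_ge0// f0// (le_lt_trans cM)//.
by rewrite gt_max xa.
Qed.

(** The mean slope between [x] and [y] is at least [derive1 f x] when [y] lies to the right and at
    most that when [y] lies to the left; multiplying by [y - x] gives the same inequality in both
    cases. *)
Lemma tangent_line_half_line (f : R -> R) (x y : R) :
  (forall z, z < a -> derivable f z 1) ->
  (forall u v, v < a -> u <= v -> derive1 f u <= derive1 f v) ->
  x < a -> y < a -> derive1 f x * (y - x) <= f y - f x.
Proof.
move=> df mono xa ya; have [c /andP[mc cM] ->] := MVT_half_line df xa ya.
have [xy|/ltW yx] := leP x y.
- rewrite ler_wpM2r ?subr_ge0// mono//; last by rewrite min_l in mc.
  by rewrite max_r// in cM; exact: le_lt_trans ya.
- by rewrite ler_wnM2r ?subr_le0// mono//; rewrite max_l in cM.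
Qed.

End half_line.

(** * Barriers on the negative axis and their derivatives *)

Section barrier_theory.
Context {R : realType} {b : R -> \bar R}.
Hypothesis hb : barrier b.
Local Notation f := (fine \o b).
Local Notation f' := (derive1 f).

Lemma barrier_ge0 t : 0 <= t -> b t = +oo%E.
Proof.
move=> t0; apply/eqP; rewrite -leye_eq leNgt; apply/negP => bt.
have : dom b t by [].
by rewrite (barrier_dom hb)/= ltNge t0.
Qed.

Lemma barrier_lt0 t : t < 0 -> b t = (f t)%:E.
Proof.
move=> t0; rewrite /= fineK// fin_numE.
have [-> _]/= := barrier_proper hb.
have : dom b t by rewrite (barrier_dom hb).
by rewrite /dom/= => /lt_eqF ->.
Qed.

Lemma barrier_derivable t : t < 0 -> derivable f t 1.
Proof. by case/(barrier_C2 hb). Qed.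

Lemma barrier_derivable2 t : t < 0 -> derivable f' t 1.
Proof. by case/(barrier_C2 hb). Qed.

Lemma derive1_barrier_mono u v : v < 0 -> u <= v -> f' u <= f' v.
Proof.
apply: ge0_derive1_half_line; first exact: barrier_derivable2.
by move=> z /(barrier_d2_gt0 hb)/ltW.
Qed.

Lemma derive1_barrier_smono u v : v < 0 -> u < v -> f' u < f' v.
Proof.
move=> v0 uv; have u0 := lt_trans uv v0.
have [c /andP[_ cM] E] := MVT_half_line barrier_derivable2 u0 v0.
rewrite -subr_gt0 E mulr_gt0 ?subr_gt0//; apply: (barrier_d2_gt0 hb).
by rewrite (le_lt_trans cM)// gt_max u0.
Qed.

(** The form in which convexity of [b] yields the conjugate, the value of [psi] and its
    subgradient. *)
Lemma barrier_tangent x y : x < 0 -> y < 0 -> f' x * (y - x) <= f y - f x.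
Proof.
apply: tangent_line_half_line; first exact: barrier_derivable.
exact: derive1_barrier_mono.
Qed.

Lemma psi_objective_lt0 rho t z :
  t - z < 0 -> psi_objective b rho t z = (rho * z + f (t - z))%:E.
Proof. by move=> tz; rewrite /psi_objective barrier_lt0. Qed.

Lemma psi_le rho t z : 0 <= z -> (psi b rho t <= psi_objective b rho t z)%E.
Proof. by move=> z0; apply: ereal_inf_lbound; exists z. Qed.

(* A minimizer z of the problem defining psi at 0 is positive, since
   b 0 = +oo, so that - z is an interior minimizer of f s - rho * s. *)
Lemma critical_point rho : psi_attained b rho ->
  exists2 s, s < 0 & f' s = rho.
Proof.
move=> /(_ 0)[z z0 psiz].
have zgt0 : 0 < z.
  rewrite lt_neqAle z0 andbT; apply/eqP => z0E.
  (* The competitor [1] has a finite objective, so the minimum is finite. *)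
  have := psi_le rho 0 (ler01 : 0 <= 1 :> R).
  rewrite psiz {1}/psi_objective -z0E mulr0 subrr barrier_ge0// addey//.
  by rewrite psi_objective_lt0 ?sub0r ?oppr_lt0// leNgt ltry.
exists (- z); first by rewrite oppr_lt0.
pose g (s : R) := f s - rho * s.
have gd (s : R) : s < 0 -> is_derive s 1 g (f' s - rho).
  move=> s0; have fs : is_derive s 1 f (f' s).
    by rewrite derive1E; apply: DeriveDef => //; exact: barrier_derivable.
  apply: is_deriveB => //.
  have : is_derive s 1 (rho *: (@id R)) (rho *: 1) by exact: is_deriveZ.
  by rewrite /GRing.scale/= mulr1.
(* Fermat's rule is applied on an open interval around [- z] inside the domain of [b]. *)
have itv0 s : s \in `](- z - 1), 0[ -> s < 0 by rewrite in_itv/= => /andP[].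
have mz : - z \in `](- z - 1), (0 : R)[.
  by rewrite in_itv/= gtrBl ltr01 oppr_lt0.
have [||s sI|_ E] := @derive1_at_min R g (- z - 1) 0 (- z) _ _ mz.
- by rewrite -opprD oppr_le0 addr_ge0.
- by move=> s /itv0/gd[].
(* The admissible point [- s] has objective [g s] at [t = 0], so minimality of [z] compares
   [g (- z)] with [g s]. *)
- have s0 := itv0 _ sI; have ns0 : 0 < - s by rewrite oppr_gt0.
  have := psi_le rho 0 (ltW ns0).
  rewrite psiz !psi_objective_lt0 ?sub0r ?oppr_lt0 ?opprK// lee_fin /g !mulrN.
  by lra.
- have z0' : - z < 0 by rewrite oppr_lt0.
  by have [_] := gd _ z0'; rewrite E => /esym/eqP; rewrite subr_eq0 => /eqP.
Qed.

(** * The envelope [psi] in terms of the point [s] where the slope of [b] is [rho] *)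

Section envelope.
Context {rho s : R}.
Hypotheses (s0 : s < 0) (f's : f' s = rho).

(* q t is the value of t - z at the minimizing z, and h = psi. *)
Let q (t : R) := Order.min t s.
Let h (t : R) := f (q t) + rho * (t - q t).
Let p (t : R) := f' (q t).

Let q_lt0 t : q t < 0.
Proof. by rewrite /q gt_min s0 orbT. Qed.

Let p_le t : p t <= rho.
Proof. by rewrite /p -f's derive1_barrier_mono// /q ge_min lexx orbT. Qed.

(** The tangent to [b] at [s] has slope [rho], so the supremum is reached at [s]; points outside the
    domain contribute [-oo]. *)
Lemma conjugate_barrier : conjugate b rho = (rho * s - f s)%:E.
Proof.
apply/eqP; rewrite eq_le; apply/andP; split.
- apply: ge_ereal_sup => _ [t _ <-].
  have [t0|t0] := ltP t 0; last by rewrite (barrier_ge0 t0) addeNy leNye.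
  rewrite barrier_lt0// lee_fin; have := barrier_tangent s0 t0.
  by rewrite f's; lra.
- by apply: ereal_sup_ubound; exists s => //; rewrite barrier_lt0.
Qed.

Lemma psi_barrier t : psi b rho t = (h t)%:E.
Proof.
have qt : 0 <= t - q t by rewrite subr_ge0 /q ge_min lexx.
apply/eqP; rewrite eq_le; apply/andP; split.
- apply: le_trans (psi_le _ _ qt) _.
  by rewrite psi_objective_lt0 subKr// lee_fin addrC.
- apply: le_ereal_inf_tmp => _ [z/= z0 <-].
  have [tz|tz] := ltP (t - z) 0; last first.
    by rewrite /psi_objective barrier_ge0// addey// leey.
  rewrite psi_objective_lt0// lee_fin /h.
  have := barrier_tangent (q_lt0 t) tz.
  set d := f (t - z) - _ => H.
  have E : f (t - z) = d + f (q t) by rewrite /d subrK.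
  (* For [t <= s] the common factor is [- z <= 0] and the slope at [t] is at most [rho]; for [t > s]
     the two slopes coincide. *)
  rewrite E; suff : rho * (t - z - q t) <= f' (q t) * (t - z - q t) by lra.
  have [ts|ts] := leP t s.
    rewrite [q t]min_l// ler_wnM2r//.
      by rewrite addrAC subrr add0r oppr_le0.
    by rewrite -f's derive1_barrier_mono.
  by rewrite [q t](min_r (ltW ts)) f's.
Qed.

Let psi_fineE : fine \o psi b rho = h.
Proof. by apply/funext => t; rewrite /= psi_barrier. Qed.

(** Strict monotonicity of [f'] turns the case distinction on slopes into one on the position of [t]
    relative to [s]. *)
Lemma barrier_deriv_le t : (barrier_deriv b t <= rho%:E)%E = (t <= s).
Proof.
rewrite /barrier_deriv; have [t0|t0] := ltP t 0.
  rewrite lee_fin -f's; have [ts|st] := leP t s.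
    by rewrite derive1_barrier_mono.
  by apply/negbTE; rewrite -ltNge derive1_barrier_smono.
by rewrite leye_eq/=; apply/esym/negbTE; rewrite -ltNge (lt_le_trans s0).
Qed.

Lemma psi_cases t : psi b rho t =
  if (barrier_deriv b t <= rho%:E)%E then b t
  else ((rho * t)%:E - conjugate b rho)%E.
Proof.
rewrite barrier_deriv_le psi_barrier /h /q; case: leP => ts.
  by rewrite subrr mulr0 addr0 barrier_lt0// (le_lt_trans ts).
(* Beyond [s], [h] follows the tangent to [b] at [s], whose value at [0] is minus the conjugate. *)
by rewrite conjugate_barrier -EFinB; congr EFin; ring.
Qed.

Lemma psi_subgradient x y :
  p x * (y - x) <= (fine \o psi b rho) y - (fine \o psi b rho) x.
Proof.
rewrite psi_fineE /h.
have := barrier_tangent (q_lt0 x) (q_lt0 y).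
set d := f (q y) - f (q x) => H; rewrite -/(p x) in H.
(* This product is what remains after the tangent inequality from [q x] to [q y]. If [x <= s], the
   second factor is [y - q y]; otherwise the first one vanishes. *)
suff H2 : 0 <= (rho - p x) * ((y - x) - (q y - q x)) by rewrite /d in H *; lra.
have [xs|sx] := leP x s.
  rewrite mulr_ge0 ?subr_ge0 ?p_le//.
  by rewrite [q x]min_l// lerB// ge_min lexx.
by rewrite /p [q x](min_r (ltW sx)) f's subrr mul0r.
Qed.

Lemma continuous_subgradient : continuous p.
Proof.
move=> x; apply: continuous_comp.
  by apply: continuous_min; [exact: cvg_id|exact: cvg_cst].
apply/differentiable_continuous/derivable1_diffP.
exact: barrier_derivable2.
Qed.

Lemma derive1_psi : derive1 (fine \o psi b rho) = p.
Proof.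
apply/funext => x; rewrite derive1E.
by have [] := subgradient_derivable psi_subgradient (@continuous_subgradient x).
Qed.

Lemma derivable_psi t : derivable (fine \o psi b rho) t 1.
Proof.
by have [] := subgradient_derivable psi_subgradient (@continuous_subgradient t).
Qed.

Lemma derive1_psi_min t :
  (derive1 (fine \o psi b rho) t)%:E = mine (barrier_deriv b t) rho%:E.
Proof.
rewrite derive1_psi /p /q; have [ts|st] := leP t s.
  by rewrite min_l ?barrier_deriv_le// /barrier_deriv (le_lt_trans ts).
by rewrite f's min_r//; apply: ltW; rewrite ltNge barrier_deriv_le -ltNge.
Qed.

Lemma subgradient_gt0 t : 0 < p t.
Proof. exact: (barrier_d1_gt0 hb). Qed.

(** Needed for composition with a convex function; it holds because the subgradients are
    positive. *)
Lemma psi_mono : {homo (fine \o psi b rho) : x y / x <= y}.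
Proof.
move=> x y xy; rewrite -subr_ge0; apply: le_trans (psi_subgradient x y).
by rewrite mulr_ge0 ?subr_ge0// ltW// subgradient_gt0.
Qed.

Lemma psi_lipschitz : rho.-lipschitz (fine \o psi b rho : R^o -> R^o).
Proof.
move=> [x y] _; apply: (subgradient_dist psi_subgradient) => z.
by rewrite ger0_norm ?p_le// ltW// subgradient_gt0.
Qed.

(** The hypothesis controls the second derivative far to the left; on the remaining compact segment
    ending at [s], continuity does. *)
Lemma derive1n2_bounded : d2_bounded_at_ninfty b ->
  exists2 L, 0 <= L & forall t, t <= s -> `|derive1n 2 f t| <= L.
Proof.
move=> [M [A [_ hA]]].
pose A' := Order.min (A - 1) s.
have A's : A' <= s by rewrite /A' ge_min lexx orbT.
have [|c _ hc] := @EVT_max R (derive1n 2 f) A' s A's.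
  apply: continuous_in_subspaceT => t; rewrite inE/= in_itv/= => /andP[_ ts].
  by have [] := barrier_C2 hb (le_lt_trans ts s0).
exists (Order.max 0 (Order.max M (derive1n 2 f c))).
  by rewrite le_max lexx.
move=> t ts; have t0 := le_lt_trans ts s0.
rewrite ger0_norm; last exact/ltW/(barrier_d2_gt0 hb).
have [At|tA] := leP A' t.
  by rewrite !le_max (hc t) ?orbT// in_itv/= At.
rewrite !le_max hA ?orbT// (lt_le_trans tA)// /A' ge_min gerBl ler01//.
Qed.

(** The derivative is [f'] after truncation at [s]: the mean value theorem makes [f'] Lipschitz up
    to [s], and the truncation [q] is nonexpansive. *)
Lemma derive1_psi_lipschitz : d2_bounded_at_ninfty b ->
  exists L, L.-lipschitz (derive1 (fine \o psi b rho) : R^o -> R^o).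
Proof.
move=> /derive1n2_bounded[L L0 hL]; exists L => -[x y] _.
rewrite derive1_psi /=.
have [c /andP[_ cM] E] :=
  MVT_half_line barrier_derivable2 (q_lt0 y) (q_lt0 x).
rewrite /p E normrM ler_pM//.
  by apply: hL; rewrite (le_trans cM)// ge_max /q !ge_min lexx !orbT.
rewrite /q; have [xs|sx] := leP x s; have [ys|sy] := leP y s => //.
- by rewrite !ler0_norm; lra.
- by rewrite !ger0_norm; lra.
- by rewrite subrr normr0.
Qed.

End envelope.

End barrier_theory.

Local Open Scope ereal_scope.

Theorem theorem3p5 (R : realType) (b : R -> \bar R) (hb : barrier b)
    (rho : R) (hrho : (0 < rho)%R) (hmin : psi_attained b rho) :
  (forall t : R, psi b rho t =
     if barrier_deriv b t <= rho%:E then b t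
     else (rho * t)%:E - conjugate b rho) /\
  (forall t : R, psi b rho t \is a fin_num) /\
  convex_function (E := R^o) [set: R] (fine \o psi b rho) /\
  (forall t : R, derivable (fine \o psi b rho) t 1%R) /\
  (forall t : R, (derive1 (fine \o psi b rho) t)%:E =
     mine (barrier_deriv b t) rho%:E) /\
  (d2_bounded_at_ninfty b ->
     exists L : R, L.-lipschitz (derive1 (fine \o psi b rho) : R^o -> R^o)) /\
  rho.-lipschitz (fine \o psi b rho : R^o -> R^o) /\
  (forall (n : nat) (c : 'rV[R]_n -> R),
     convex_function (E := 'rV[R]_n) [set: 'rV[R]_n] c ->
     convex_function (E := 'rV[R]_n) [set: 'rV[R]_n]
       (fine \o psi b rho \o c)).
Proof.
have [s s0 f's] := critical_point hb hmin.
have psi_conv := subgradient_conv (psi_subgradient hb s0 f's).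
repeat split.
- exact: (psi_cases hb s0 f's).
- by move=> t; rewrite (psi_barrier hb s0 f's).
- by move=> t x y _ _; exact: psi_conv.
- exact: (derivable_psi hb s0 f's).
- exact: (derive1_psi_min hb s0 f's).
- exact: (derive1_psi_lipschitz hb s0 f's).
- exact: (psi_lipschitz hb s0 f's).
(* Monotonicity of [psi] carries over the convexity inequality of [c]; convexity of [psi] at [c x]
   and [c y] concludes. *)
- move=> n c cc t x y xD yD; apply: le_trans (psi_conv t (c x) (c y)).
  by apply: (psi_mono hb s0 f's); exact: cc.
Qed.
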